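(* Let $a,b\geq 0$ and $g\geq 3$ be integers. An $(a,b,g)$-wcage exists if and only if an $(a,b,g)$-wcycle exists.
   Context: A weighted graph (wgraph) is a pair $G=(L,H)$ of simple finite graphs with $V(L)=V(H)$ and $E(L)\cap E(H)=\varnothing$; edges of $L$ are light (weight 1) and edges of $H$ are heavy (weight 2). A wcycle is a cycle (of length at least 3) in the graph with vertex set $V(L)$ and edge set $E(L)\cup E(H)$; its weight is the sum of the weights of its edges. The girth of a wgraph is the minimum weight of its wcycles. $G$ is $(a,b)$-regular if $L$ is $a$-regular and $H$ is $b$-regular. An $(a,b,g)$-wgraph is an $(a,b)$-regular wgraph of girth $g$, and an $(a,b,g)$-wcage is an $(a,b,g)$-wgraph of minimum order. An $(a,b,g)$-wcycle is a wcycle $C$ (regarded as a wgraph consisting of its light edges and its heavy edges) of weight $g$ such that every vertex of $C$ is incident with at most $a$ light edges and at most $b$ heavy edges of $C$. *)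

(* Defs.v *)
From mathcomp Require Import all_boot.

Set Implicit Arguments.
Unset Strict Implicit.
Unset Printing Implicit Defensive.

Record sgraph (V : finType) := SGraph {
  edge :> rel V;
  edge_sym : symmetric edge;
  edge_irr : irreflexive edge
}.

Definition degree (V : finType) (G : sgraph V) (x : V) : nat :=
  #|[set y | G x y]|.

Definition regular (V : finType) (G : sgraph V) (d : nat) : Prop :=
  forall x : V, degree G x = d.

Record wgraph (V : finType) := WGraph {
  light : sgraph V;
  heavy : sgraph V;
  light_heavy_disj : forall x y : V, ~~ (light x y && heavy x y)
}.

Definition wadj (V : finType) (G : wgraph V) : rel V :=
  [rel x y | light G x y || heavy G x y].

(* The last value is taken only on non-edges. *)
Definition edge_weight (V : finType) (G : wgraph V) (x y : V) : nat :=
  if light G x y then 1 else if heavy G x y then 2 else 0.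

(* A cycle is given by the sequence of its distinct vertices in cyclic order;
   rotations and reversals of the sequence represent the same cycle. *)
Definition wcycle (V : finType) (G : wgraph V) (s : seq V) : Prop :=
  2 < size s /\ ucycle (wadj G) s.

Definition weight (V : finType) (G : wgraph V) (s : seq V) : nat :=
  \sum_(x <- s) edge_weight G x (next s x).

(* An acyclic wgraph has no girth. *)
Definition has_girth (V : finType) (G : wgraph V) (g : nat) : Prop :=
  (exists2 s : seq V, wcycle G s & weight G s = g) /\
  (forall s : seq V, wcycle G s -> g <= weight G s).

Definition abg_wgraph (a b g : nat) (V : finType) (G : wgraph V) : Prop :=
  [/\ regular (light G) a, regular (heavy G) b & has_girth G g].

Definition abg_wcage (a b g : nat) (V : finType) (G : wgraph V) : Prop :=
  abg_wgraph a b g G /\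
  (forall (W : finType) (K : wgraph W), abg_wgraph a b g K -> #|V| <= #|W|).

Section CycleWGraph.
Variables (V : finType) (s : seq V).

Definition consecutive : rel V := [rel x y | (y == next s x) || (x == next s y)].

Definition cycle_rel (G : sgraph V) : rel {x : V | x \in s} :=
  [rel x y | G (val x) (val y) && consecutive (val x) (val y)].

Lemma cycle_rel_sym (G : sgraph V) : symmetric (cycle_rel G).
Proof. by move=> x y; congr (_ && _); [exact: edge_sym | exact: orbC]. Qed.

Lemma cycle_rel_irr (G : sgraph V) : irreflexive (cycle_rel G).
Proof. by move=> x; apply/negP => /andP[]; rewrite (edge_irr G). Qed.

Definition cycle_sgraph (G : sgraph V) : sgraph {x : V | x \in s} :=
  SGraph (cycle_rel_sym G) (cycle_rel_irr G).

Lemma cycle_disj (G : wgraph V) (x y : {x : V | x \in s}) :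
  ~~ (cycle_sgraph (light G) x y && cycle_sgraph (heavy G) x y).
Proof.
apply: contra (light_heavy_disj G (val x) (val y)).
by move=> /andP[/andP[-> _] /andP[-> _]].
Qed.

(* The subgraph of G formed by the vertices and edges of the cycle s; it need
   not be induced, as chords of s in G are left out. *)
Definition cycle_wgraph (G : wgraph V) : wgraph {x : V | x \in s} :=
  WGraph (cycle_disj G).

End CycleWGraph.

Definition abg_wcycle (a b g : nat) (V : finType) (G : wgraph V) (s : seq V) :
    Prop :=
  [/\ wcycle G s, weight G s = g &
      forall x : {x : V | x \in s},
        degree (light (cycle_wgraph s G)) x <= a /\
        degree (heavy (cycle_wgraph s G)) x <= b].

(* Main.v *)
(* A girth cycle of a wcage is an (a,b,g)-wcycle.  Conversely, take the wgraph C
   consisting of a given wcycle alone, and a finite group generated by one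
   involution for every missing edge-end of C, in which no nonempty reduced word
   of length at most g is trivial.  Take one copy of C for each group element h,
   and supply the missing edge-end c of the vertex x by joining the copies of x
   in C_h and C_hc.  A cycle that leaves its copy of C reads off a trivial reduced
   word, so it has more than g edges; every other cycle has weight g.  Hence an
   (a,b,g)-wgraph exists, and so does one of minimum order. *)

Require Import Defs.
From mathcomp Require Import all_boot.
From mathcomp Require Import fingroup perm.
From Stdlib Require Import Classical.

Set Implicit Arguments.
Unset Strict Implicit.
Unset Printing Implicit Defensive.

(** * Involutions satisfying no short relation *)

Section Involutions.
Variables (C : finType) (g : nat).

Definition reduced (w : seq C) : bool := sorted (fun c d => c != d) w.

(** Non-reduced words, and words of length [g] with nothing to cancel, stay fixed. This makes the
    map an involution on all sequences of length at most [g], so no type of reduced words is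
    needed. *)
Definition toggle (c : C) (w : seq C) : seq C :=
  if reduced w && (ohead w == Some c) then behead w
  else if reduced (c :: w) && (size w < g) then c :: w else w.

Lemma toggle_size c w : size w <= g -> size (toggle c w) <= g.
Proof.
rewrite /toggle => le_wg; case: ifP => _.
  by rewrite size_behead (leq_trans (leq_pred _)).
by case: ifP => // /andP[].
Qed.

Lemma toggleK c w : size w <= g -> toggle c (toggle c w) = w.
Proof.
rewrite {2}/toggle => le_wg; case: ifP => [/andP[]|nw].
  case: w le_wg => //= d w lt_wg rw /eqP[eq_dc]; subst d.
  rewrite /toggle [reduced (c :: w)]rw lt_wg.
  case: w rw {lt_wg} => //= d w /andP[cd _].
  by rewrite [Some d == _]eq_sym (inj_eq Some_inj) (negPf cd) andbF.
case: ifP => [/andP[rcw _]|nw']; first by rewrite /toggle rcw /= eqxx.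
by rewrite /toggle nw nw'.
Qed.

Definition btoggle (c : C) (w : g.-bseq C) : g.-bseq C :=
  Bseq (toggle_size c (size_bseq w)).

Lemma btoggleK c : involutive (btoggle c).
Proof. by move=> w; apply: val_inj; rewrite /= toggleK ?size_bseq. Qed.

Definition toggle_perm (c : C) : {perm g.-bseq C} := perm (inv_inj (btoggleK c)).

(** A product of permutations applies its left factor first, so the letters of [w] are pushed onto
    [u] one by one; since the final word is reduced and short enough, each step is a genuine
    prepending. *)
Lemma toggle_perm_prod (w : seq C) (u : g.-bseq C) :
  reduced (catrev w u) -> size w + size u <= g ->
  (\prod_(c <- w) toggle_perm c)%g u = catrev w u :> seq C.
Proof.
elim: w u => [|c w IHw] u /=; first by rewrite big_nil perm1.
move=> rw le_g; rewrite big_cons permM permE.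
have rcu : reduced (c :: u) by move: rw; rewrite catrevE => /cat_sorted2[].
have lt_ug : size u < g by apply: leq_trans le_g; rewrite ltnS leq_addl.
have def_u : btoggle c u = c :: u :> seq C.
  rewrite /= /toggle rcu lt_ug; case: (val u) rcu => //= d v /andP[cd _].
  by rewrite [Some d == _]eq_sym (inj_eq Some_inj) (negPf cd) andbF.
by rewrite IHw def_u // /= addnS.
Qed.

(* Biggs: let each generator act on the reduced words of length at most g by
   prepending or cancelling a letter.  A reduced word then moves the empty word
   to its own mirror image. *)
Lemma involutions_without_short_relations :
  exists (gT : finGroupType) (P : C -> gT),
    (forall c, P c * P c = 1)%g /\
    (forall w, reduced w -> 0 < size w <= g -> (\prod_(c <- w) P c)%g != 1%g).
Proof.
exists {perm g.-bseq C}, toggle_perm; split=> [c|w rw /andP[w_gt0 le_wg]].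
  by apply/permP=> u; rewrite permM !permE btoggleK.
apply/eqP=> Pw1; have := @toggle_perm_prod w [bseq].
rewrite Pw1 perm1 /= addn0 => /(_ _ le_wg).
rewrite catrevE cats0 /reduced rev_sorted.
have -> : sorted (fun c d => d != c) w = reduced w.
  by apply: eq_sorted => c d; rewrite eq_sym.
by move/(_ rw)/(congr1 size); rewrite size_rev /= => w0; rewrite -w0 in w_gt0.
Qed.

End Involutions.

Lemma eq_mulg_self (gT : finGroupType) (h k : gT) : (h == h * k)%g = (k == 1)%g.
Proof. by rewrite eq_sym -(inj_eq (mulgI h) k 1%g) mulg1. Qed.

(** * Joining copies of a graph along missing edge-ends *)

Section LiftGraph.
Variables (V : finType) (gT : finGroupType) (d : nat).
Variables (L : sgraph V) (P : V -> 'I_d -> gT).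
Hypothesis P_invol : forall x j, (P x j * P x j)%g = 1%g.
Hypothesis P_neq1 : forall x j, P x j != 1%g.

(** When the degree of [x] is at most [d], exactly [d - degree L x] indices [j] satisfy
    [degree L x + j < d]: one for each edge-end missing at [x]. *)
Definition lift_rel : rel (V * gT) := [rel p q |
  (p.2 == q.2) && L p.1 q.1 ||
  (p.1 == q.1) &&
  [exists j : 'I_d, (degree L p.1 + j < d) && (q.2 == p.2 * P p.1 j)%g]].

Lemma lift_rel_sym : symmetric lift_rel.
Proof.
suff lift_imp p q : lift_rel p q -> lift_rel q p.
  by move=> p q; apply/idP/idP; apply: lift_imp.
case: p q => [x h] [y k]; rewrite /lift_rel /= [h == k]eq_sym [L x y]edge_sym.
case/orP=> [->//|/andP[/eqP<- /existsP[j /andP[lt_jd /eqP->]]]].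
rewrite eqxx orbC /=; apply/orP; left; apply/existsP; exists j.
by rewrite lt_jd -mulgA P_invol mulg1 eqxx.
Qed.

Lemma lift_rel_irr : irreflexive lift_rel.
Proof.
move=> [x h]; rewrite /lift_rel /= (edge_irr L) andbF eqxx /=.
apply/existsP=> -[j /andP[_]].
by rewrite eq_mulg_self (negPf (P_neq1 x j)).
Qed.

Definition lift_graph : sgraph (V * gT)%type := SGraph lift_rel_sym lift_rel_irr.

Lemma lift_graph_same x y h : lift_graph (x, h) (y, h) = L x y.
Proof.
rewrite /= /lift_rel /= eqxx orbC; case: existsP => [[j /andP[_]]|]; last by rewrite andbF.
by rewrite eq_mulg_self (negPf (P_neq1 x j)).
Qed.

Lemma lift_graphP p q : lift_graph p q ->
  (p.2 = q.2 /\ L p.1 q.1) \/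
  (p.1 = q.1 /\ exists j, q.2 = p.2 * P p.1 j)%g.
Proof.
case/orP=> /andP[/eqP-> H]; [by left | right; split=> //].
by case/existsP: H => j /andP[_ /eqP->]; exists j.
Qed.

(** The neighbours of [(x, h)] in its own copy ([N1]) and in other copies ([N2]) are disjoint
    because no generator is trivial; injectivity of [P x] makes [N2] as large as the deficiency of
    [x]. *)
Lemma lift_graph_regular :
  (forall x, injective (P x)) -> (forall x, degree L x <= d) ->
  regular lift_graph d.
Proof.
move=> P_inj le_Ld [x h]; rewrite /degree.
pose N1 := [set (y, h) | y in [set y | L x y]].
pose N2 := [set (x, h * P x j)%g | j in [set j : 'I_d | degree L x + j < d]].
have -> : [set q | lift_graph (x, h) q] = N1 :|: N2.
  apply/setP=> -[y k]; rewrite !inE /= /lift_rel /=; congr (_ || _).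
    apply/andP/imsetP => [[/eqP<- Lxy]|[z]]; first by exists y; rewrite ?inE.
    by rewrite inE => Lxz [-> ->].
  apply/andP/imsetP => [[/eqP<- /existsP[j /andP[lt_jd /eqP->]]]|[j]].
    by exists j; rewrite ?inE.
  rewrite inE => lt_jd [-> ->]; split=> //.
  by apply/existsP; exists j; rewrite lt_jd /=.
have dis : N1 :&: N2 = set0.
  apply/setP=> q; rewrite !inE; apply/negP=> /andP[/imsetP[y _ ->]].
  case/imsetP=> j _ [_] /eqP.
  by rewrite eq_mulg_self (negPf (P_neq1 x j)).
rewrite cardsU dis cards0 subn0 !card_imset; first last.
- by move=> y z [].
- by move=> i j [] /mulgI /P_inj.
rewrite -/(degree L x).
have -> : #|[set j : 'I_d | degree L x + j < d]| = d - degree L x.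
  rewrite -sum1dep_card (eq_bigl (fun j : 'I_d => j < d - degree L x)).
    by rewrite (big_ord_narrow (leq_subr _ _)) sum1_card card_ord.
  by move=> j; rewrite ltn_subRL.
by rewrite subnKC.
Qed.

End LiftGraph.

(** * Regularity and girth of the lifted wgraph *)

Lemma weight_ge_size (V : finType) (G : wgraph V) (s : seq V) :
  wcycle G s -> size s <= weight G s.
Proof.
case=> _ /andP[cyc_s _]; rewrite -sum1_size /weight !big_seq.
(* Successive vertices are adjacent, so the default weight 0 never occurs. *)
apply: leq_sum => x /(next_cycle cyc_s); rewrite /wadj /edge_weight /=.
by case: ifP => // _ /= ->.
Qed.

Section Regularization.
Variables (V : finType) (G : wgraph V) (a b g : nat) (gT : finGroupType).
Variable P : V * ('I_a + 'I_b) -> gT.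
Hypothesis g_gt1 : 1 < g.
Hypothesis P_invol : forall c, (P c * P c)%g = 1%g.
Hypothesis P_free :
  forall w, reduced w -> 0 < size w <= g -> (\prod_(c <- w) P c)%g != 1%g.
Hypothesis light_le : forall x, degree (light G) x <= a.
Hypothesis heavy_le : forall x, degree (heavy G) x <= b.
Hypothesis girthG : has_girth G g.

Lemma gen_neq1 c : P c != 1%g.
Proof. by have := @P_free [:: c]; rewrite big_seq1 /= (ltnW g_gt1); apply. Qed.

(** If distinct [c] and [d] had the same image, the reduced word [[:: c; d]] would be a relation of
    length 2, which is at most [g]. *)
Lemma gen_inj : injective P.
Proof.
move=> c d eqP; apply: contraTeq isT => ncd.
have := @P_free [:: c; d]; rewrite /= ncd g_gt1 => /(_ isT isT).
by rewrite big_cons big_seq1 -eqP P_invol eqxx.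
Qed.

Let Pl x (j : 'I_a) := P (x, inl j).
Let Ph x (j : 'I_b) := P (x, inr j).

Definition lift_light := lift_graph (light G) (P := Pl)
  (fun x j => P_invol (x, inl j)) (fun x j => gen_neq1 (x, inl j)).
Definition lift_heavy := lift_graph (heavy G) (P := Ph)
  (fun x j => P_invol (x, inr j)) (fun x j => gen_neq1 (x, inr j)).

(** Inside a copy this is disjointness in [G]; between copies, a common edge would give a light and
    a heavy letter the same generator. *)
Lemma lift_disj p q : ~~ (lift_light p q && lift_heavy p q).
Proof.
case: p q => [x h] [y k]; case: (eqVneq h k) => [->|/eqP nhk].
  by rewrite !lift_graph_same light_heavy_disj.
apply/negP=> /andP[Lpq Hpq].
case: (lift_graphP Lpq) => /= [[]//|[_ [i def_k]]].
case: (lift_graphP Hpq) => /= [[]//|[_ [j]]].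
by rewrite def_k => /mulgI/gen_inj.
Qed.

Definition lift_wgraph : wgraph (V * gT)%type := WGraph lift_disj.

Lemma lift_wadjP p q : wadj lift_wgraph p q ->
  (p.2 = q.2 /\ wadj G p.1 q.1) \/
  (p.1 = q.1 /\ exists2 c, c.1 = p.1 & q.2 = p.2 * P c)%g.
Proof.
case/orP=> /lift_graphP[[eq2 Gpq]|[eq1 [j def_q]]].
- by left; rewrite /wadj /= Gpq.
- by right; split=> //; exists (p.1, inl j).
- by left; rewrite /wadj /= Gpq orbT.
- by right; split=> //; exists (p.1, inr j).
Qed.

Lemma lift_wadj_same x y h : wadj lift_wgraph (x, h) (y, h) = wadj G x y.
Proof. by congr orb; apply: lift_graph_same. Qed.

Lemma lift_weight_same x y h :
  edge_weight lift_wgraph (x, h) (y, h) = edge_weight G x y.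
Proof. by rewrite /edge_weight !lift_graph_same. Qed.

Lemma lift_wcycle h (s : seq V) :
  wcycle lift_wgraph (map (pair^~ h) s) <-> wcycle G s.
Proof.
have pairh_inj : injective (pair^~ h : V -> V * gT) by move=> x y [].
rewrite /wcycle size_map /ucycle map_inj_uniq //.
by rewrite (mono_cycle (e := wadj G)) // => x y; apply: lift_wadj_same.
Qed.

Lemma lift_weight h (s : seq V) : uniq s ->
  weight lift_wgraph (map (pair^~ h) s) = weight G s.
Proof.
have pairh_inj : injective (pair^~ h : V -> V * gT) by move=> x y [].
move=> Us; rewrite /weight big_map; apply: eq_bigr => x _.
by rewrite (next_map pairh_inj) // lift_weight_same.
Qed.

(* The condition on [take 2 p] says that the path does not immediately return
   along its first edge, which keeps the word reduced; the last clause is what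
   the induction needs to see this. *)
Lemma path_word (u : V * gT) (p : seq (V * gT)) :
  path (wadj lift_wgraph) u p -> uniq p -> u \notin take 2 p ->
  exists w : seq (V * ('I_a + 'I_b)),
    [/\ reduced w, size w <= size p,
        (last u p).2 = (u.2 * \prod_(c <- w) P c)%g,
        w = [::] -> all (fun v => v.2 == u.2) p &
        forall c w', w = c :: w' -> exists p1 v p2,
          [/\ p = p1 ++ v :: p2, last u p1 = (c.1, u.2)
            & v = (c.1, u.2 * P c)%g]].
Proof.
elim: p u => [|v p IHp] u /=.
  by exists [::]; rewrite big_nil mulg1.
case/andP=> Guv Gp /andP[pv Up]; rewrite inE negb_or => /andP[_ uNp].
have [|||w [rw le_w lastw w0 first_w]] // := IHp v.
  by apply: contra pv => /mem_take.
case/lift_wadjP: Guv => [[eq2 _]|[eq1 [c c1 v2]]].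
  exists w; split=> //; rewrite ?eq2 ?(leqW le_w) //.
    by move=> /w0; rewrite eqxx.
  move=> c w' /first_w[p1 [z [p2 [-> lastp1 ->]]]].
  by exists (v :: p1), (c.1, v.2 * P c)%g, p2.
have def_v : v = (c.1, u.2 * P c)%g.
  by case: (v) v2 eq1 => ? ? /= -> <-; rewrite c1.
exists (c :: w); split=> //.
- case: w {lastw w0 le_w} rw first_w => [//|d w] rw first_w.
  rewrite /reduced /= andbC; apply/andP; split; first exact: rw.
  (* If the next letter is again [c], the next change of copy leads from [v] back to [u]. Either it
     happens at once, so [u] is the second vertex of the path, or the path has returned to [v]
     first, against uniqueness. *)
  apply: contraNneq uNp => eq_cd; subst d.
  have [p1 [z [p2 [def_p lastp1 def_z]]]] := first_w c w erefl.
  case: p1 => [|y p1] in def_p lastp1.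
    rewrite def_p def_z v2 -mulgA P_invol mulg1 c1 -surjective_pairing.
    exact: mem_head.
  case/negP: pv; rewrite def_p mem_cat; apply/orP; left.
  by rewrite [X in X \in _]def_v -v2 -lastp1 /= mem_last.
- by rewrite lastw big_cons v2 mulgA.
- move=> d w' [<- _]; exists [::], v, p; split=> //=.
  by rewrite c1 -surjective_pairing.
Qed.

(** Read as a path from [u] back to [u], the cycle yields a reduced word with trivial product. An
    empty word confines the cycle to one copy of [G]; a nonempty one is longer than [g], and the
    weight is at least the number of edges. *)
Lemma lift_wcycle_weight s : wcycle lift_wgraph s -> g <= weight lift_wgraph s.
Proof.
move=> cyc_s; have [s_gt2 /andP[]] := cyc_s.
case: s => [//|u q] in cyc_s s_gt2 * => /= Gq /andP[uNq Uq].
have [||w [rw le_w lastw w0 _]] := path_word Gq.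
- by rewrite rcons_uniq uNq.
(* The path is [rcons q u]; as [q] has at least two entries, the final [u] is not among the first
   two. *)
- case: q s_gt2 uNq {cyc_s Gq Uq} => [|y [|z q]] //= _.
  by rewrite take0 !inE !negb_or => /and3P[-> ->].
have [/size0nil/w0 same|w_gt0] := posnP (size w).
  have def_s : u :: q = map (pair^~ u.2) (map fst (u :: q)).
    rewrite -map_comp -[LHS]map_id; apply/eq_in_map => v vs /=.
    rewrite [LHS]surjective_pairing; congr pair.
    by apply/eqP; apply: (allP same); rewrite mem_rcons.
  move: cyc_s; rewrite def_s => /lift_wcycle cyc_s.
  by rewrite lift_weight; [apply: girthG.2 | case: cyc_s => _ /andP[]].
apply: leq_trans (weight_ge_size cyc_s).
rewrite leqNgt; apply/negP=> lt_sg.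
have le_wg : size w <= g.
  by apply: leq_trans le_w _; rewrite size_rcons (ltnW lt_sg).
have := P_free rw; rewrite w_gt0 le_wg => /(_ isT)/eqP; apply.
apply: (mulgI u.2); rewrite mulg1 -[LHS]lastw.
by rewrite last_rcons.
Qed.

Lemma lift_abg_wgraph : abg_wgraph a b g lift_wgraph.
Proof.
split.
- by apply: lift_graph_regular => // x i j /gen_inj[].
- by apply: lift_graph_regular => // x i j /gen_inj[].
split; last exact: lift_wcycle_weight.
have [s cyc_s wt_s] := girthG.1.
exists (map (pair^~ 1%g) s); first exact/lift_wcycle.
by rewrite lift_weight //; case: cyc_s => _ /andP[].
Qed.

End Regularization.

(** * A cycle contains no other cycle *)

Lemma next_neq_prev (T : eqType) (t : seq T) x :
  uniq t -> 2 < size t -> x \in t -> next t x != prev t x.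
Proof.
move=> Ut t_gt2 /rot_to[i t' def_t].
(* Equality would mean that [x] is its own second successor, but with [x] rotated to the front that
   successor is the third entry. *)
rewrite eq_sym (can2_eq (next_prev Ut) (prev_next Ut)) -!(next_rot i Ut).
move: Ut t_gt2; rewrite -(rot_uniq i) -(size_rot i) {}def_t.
case: t' => [|y [|z t']] //= /andP[]; rewrite !inE !negb_or.
case/and3P=> nxy nxz _ _ _.
by rewrite eqxx [y == x]eq_sym (negPf nxy) eqxx.
Qed.

Section CycleUniqueness.
Variables (V : finType) (s : seq V).
Hypothesis Us : uniq s.

Lemma consecutiveE x y : consecutive s x y = (y == next s x) || (y == prev s x).
Proof.
rewrite /consecutive /= -(can2_eq (prev_next Us) (next_prev Us)).
by rewrite [x == _]eq_sym.
Qed.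

Variable t : seq V.
Hypotheses (Ut : uniq t) (t_gt2 : 2 < size t) (sub_ts : {subset t <= s}).
Hypothesis cyc_t : path.cycle (consecutive s) t.

(** The two neighbours of [x] in [t] are distinct and both adjacent to [x] along [s], so they
    exhaust its two neighbours in [s]. *)
Lemma cycle_neighbours x : x \in t ->
  (next t x = next s x /\ prev t x = prev s x) \/
  (next t x = prev s x /\ prev t x = next s x).
Proof.
move=> tx; have := next_neq_prev Ut t_gt2 tx.
have : consecutive s x (prev t x).
  by have := prev_cycle cyc_t tx; rewrite /consecutive /= orbC.
have := next_cycle cyc_t tx; rewrite !consecutiveE.
by case/orP=> /eqP-> /orP[]/eqP->; rewrite ?eqxx //; [left | right].
Qed.

(** Since [t] is closed under [next s], it contains a whole orbit, which is all of [s]. *)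
Lemma cycle_mem : t =i s.
Proof.
have next_t x : x \in t -> next s x \in t.
  move=> tx; case: (cycle_neighbours tx) => -[eq_n eq_p].
    by rewrite -eq_n mem_next.
  by rewrite -eq_p mem_prev.
have [x tx] : exists x, x \in t.
  by case: (t) t_gt2 => // x t' _; exists x; apply: mem_head.
move=> y; apply/idP/idP => [/sub_ts //|sy].
have : fconnect (next s) x y by rewrite (fconnect_cycle (cycle_next Us) (sub_ts tx)).
by move/iter_findex <-; elim: (findex _ _ _) => //= n; apply: next_t.
Qed.

(** Counting each edge from both ends gives a sum that does not depend on the direction of
    traversal. *)
Lemma sum_next_prev (r : seq V) (f : V -> V -> nat) :
  uniq r -> (forall x y, f x y = f y x) ->
  (\sum_(x <- r) f x (next r x)).*2 =
  \sum_(x in r) (f x (next r x) + f x (prev r x)).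
Proof.
move=> Ur f_sym; rewrite -addnn big_split /= -big_uniq //=; congr (_ + _).
rewrite [RHS](reindex_inj (can_inj (prev_next Ur))) /= big_uniq //.
by apply: eq_big => x; rewrite ?mem_next // prev_next // f_sym.
Qed.

(** The doubled sums agree vertex by vertex, so there is no need to show that [t] is a rotation or
    reversal of [s]. *)
Lemma cycle_sum_unique (f : V -> V -> nat) : (forall x y, f x y = f y x) ->
  \sum_(x <- t) f x (next t x) = \sum_(x <- s) f x (next s x).
Proof.
move=> f_sym; apply: double_inj; rewrite !sum_next_prev //.
rewrite -(eq_bigl _ _ cycle_mem); apply: eq_bigr => x tx.
by case: (cycle_neighbours tx) => -[-> ->] //; apply: addnC.
Qed.

End CycleUniqueness.

Lemma edge_weight_sym (V : finType) (G : wgraph V) x y :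
  edge_weight G x y = edge_weight G y x.
Proof. by rewrite /edge_weight (edge_sym (light G)) (edge_sym (heavy G)). Qed.

(** Every wcycle of [cycle_wgraph s G] maps to a cycle of consecutive vertices of [s], hence has the
    same weight as [s]. *)
Lemma cycle_wgraph_girth (V : finType) (G : wgraph V) (s : seq V) :
  wcycle G s -> has_girth (cycle_wgraph s G) (weight G s).
Proof.
case=> s_gt2 /andP[cyc_s Us].
pose S := {x : V | x \in s}; pose G' := cycle_wgraph s G.
have adjE (x y : S) :
    wadj G' x y = wadj G (val x) (val y) && consecutive s (val x) (val y).
  by rewrite /wadj /= -andb_orl.
have weightE (t : seq S) : uniq t -> path.cycle (wadj G') t ->
    weight G' t = \sum_(x <- map val t) edge_weight G x (next (map val t) x).
  move=> Ut cyc_t; rewrite big_map /weight !big_seq; apply: eq_bigr => x tx.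
  rewrite (next_map val_inj) //.
  have := next_cycle cyc_t tx; rewrite adjE => /andP[_ cons_x].
  by rewrite /edge_weight /= /cycle_rel /= cons_x !andbT.
split.
  (* The weight is attained by [s] itself, its entries moved into the subtype. *)
  pose t : seq S := pmap insub s.
  have def_s : map val t = s.
    rewrite /t (pmap_filter (insubK _)); apply/all_filterP/allP => x sx.
    by rewrite insubT.
  have Ut : uniq t by rewrite -(map_inj_uniq val_inj) def_s.
  have cyc_t : path.cycle (wadj G') t.
    have cyc_s' : path.cycle (fun x y => wadj G x y && consecutive s x y) s.
      apply: cycle_from_next => // x sx.
      by rewrite (next_cycle cyc_s) // /consecutive /= eqxx.
    move: cyc_s'; rewrite -[X in path.cycle _ X]def_s.
    by rewrite (mono_cycle (e := wadj G')) // => x y; rewrite adjE.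
  exists t; last by rewrite weightE // def_s.
  by split; [rewrite -(size_map val) def_s | rewrite /ucycle cyc_t].
move=> t [t_gt2 /andP[cyc_t Ut]]; rewrite weightE //.
rewrite (cycle_sum_unique Us) //.
- by rewrite map_inj_uniq //; apply: val_inj.
- by rewrite size_map.
- by move=> _ /mapP[x _ ->]; apply: valP.
- by rewrite cycle_map; apply: sub_cycle cyc_t => x y; rewrite adjE => /andP[].
- exact: edge_weight_sym.
Qed.

(** * Existence and minimality *)

Lemma regularize (V : finType) (G : wgraph V) (a b g : nat) :
  1 < g -> (forall x, degree (light G) x <= a) ->
  (forall x, degree (heavy G) x <= b) -> has_girth G g ->
  exists (W : finType) (K : wgraph W), abg_wgraph a b g K.
Proof.
move=> g_gt1 leLa leHb girthG.
have [gT [P [P_invol P_free]]] :=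
  involutions_without_short_relations (V * ('I_a + 'I_b))%type g.
exists (V * gT)%type, (lift_wgraph G g_gt1 P_invol P_free).
exact: lift_abg_wgraph.
Qed.

(** Descent on the order; minimality ranges over all finite types, so deciding it takes excluded
    middle. *)
Lemma minimal_wgraph (V : finType) (G : wgraph V) (a b g : nat) :
  abg_wgraph a b g G -> exists (W : finType) (K : wgraph W), abg_wcage a b g K.
Proof.
have [n] := ubnP #|V|; elim: n => // n IHn in V G * => /ltnSE-le_n abgG.
have [minG|] := classic (forall (W : finType) (K : wgraph W),
  abg_wgraph a b g K -> #|V| <= #|W|); first by exists V, G.
case/not_all_ex_not=> W nW; have [K nK] := not_all_ex_not _ _ nW.
have [abgK /negP] := imply_to_and _ _ nK.
by rewrite -ltnNge => lt_WV; apply: (IHn W K) => //; apply: leq_trans lt_WV le_n.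
Qed.

Lemma cycle_sgraph_degree (V : finType) (s : seq V) (G : sgraph V)
  (x : {x : V | x \in s}) : degree (cycle_sgraph s G) x <= degree G (val x).
Proof.
rewrite /degree -(card_imset _ val_inj); apply/subset_leq_card/subsetP => y.
by case/imsetP=> z; rewrite !inE => /andP[Gxz _] ->.
Qed.

Theorem theorem8 (a b g : nat) (hg : 3 <= g) :
  (exists (V : finType) (G : wgraph V), abg_wcage a b g G) <->
  (exists (V : finType) (G : wgraph V) (s : seq V), abg_wcycle a b g G s).
Proof.
split=> [[V [G [[regL regH [[s cyc_s wt_s] _]] _]]]
        | [V [G [s [cyc_s wt_s deg_s]]]]].
  exists V, G, s; split=> // x.
  by rewrite -(regL (val x)) -(regH (val x)); split; apply: cycle_sgraph_degree.
(* Regularization starts from the cycle alone, since [G] may contain wcycles lighter than [g] and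
   vertices of too large degree. *)
have := cycle_wgraph_girth cyc_s; rewrite wt_s => girth_s.
have [|||W [K abgK]] := @regularize _ (cycle_wgraph s G) a b g _ _ _ girth_s.
- exact: ltnW.
- by move=> x; case: (deg_s x).
- by move=> x; case: (deg_s x).
exact: minimal_wgraph abgK.
Qed.
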